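(* Let $(\mathcal{S}^x,H)$ be a finite thick skew translation generalized quadrangle of order $(s,t)$ with $s\neq t$, satisfying property ( * ), and suppose that for every line $L$ not incident with $x$ the stabilizer $H_L$ is elementary abelian. Then for every line $L$ not incident with $x$, $H_L$ contains at least $s/t>1$ elements which fix every line through the point $\mathrm{proj}_Lx$ (i.e., root-elations with i-root $(x,\,x\,\mathrm{proj}_Lx,\,\mathrm{proj}_Lx)$).
   Context: A finite generalized quadrangle (GQ) of order $(s,t)$: every line has $s+1$ points, every point is on $t+1$ lines, two points are on at most one common line, and for each point $p$ not on a line $L$ there is a unique point of $L$ collinear with $p$, denoted $\mathrm{proj}_Lp$; thick means $s,t>1$. An elation generalized quadrangle $(\mathcal{S}^x,H)$: $H\le\mathrm{Aut}(\mathcal{S})$ fixes every line through $x$ and acts sharply transitively on the points not collinear with $x$. A symmetry about $x$ is an automorphism fixing every point collinear with $x$; the EGQ is a skew translation generalized quadrangle if $H$ contains a subgroup of $t$ symmetries about $x$. Property ( * ): whenever a point $y\neq x$ collinear with $x$ is fixed by some element $h\in H$, then $h$ fixes every point of the line $xy$. *)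

(* Defs.v *)
From HB Require Import structures.
From mathcomp Require Import all_boot all_order all_algebra all_fingroup all_solvable.
Set Implicit Arguments. Unset Strict Implicit. Unset Printing Implicit Defensive.

(* A finite point-line incidence structure: points P, lines Ln, incidence I.
   Automorphisms are pairs (permutation of points, permutation of lines);
   ({perm P} * {perm Ln}) is a finGroupType (external direct product, gproduct.v). *)

Section GQ.
Variables (P Ln : finType) (I : P -> Ln -> bool).

Definition autT := ({perm P} * {perm Ln})%type.

Definition collinear (p q : P) : bool := [exists L, I p L && I q L].

Definition is_GQ (s t : nat) : Prop :=
  [/\ (forall L : Ln, #|[set p | I p L]| = s.+1),
      (forall p : P, #|[set L | I p L]| = t.+1),
      (forall (p q : P) (L M : Ln), p != q -> I p L -> I q L -> I p M -> I q M -> L = M)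
    & (forall (p : P) (L : Ln), ~~ I p L -> exists! q : P, I q L && collinear p q)].

Definition thick (s t : nat) : Prop := 1 < s /\ 1 < t.

Definition is_aut (a : autT) : Prop := forall p L, I (a.1 p) (a.2 L) = I p L.

Definition is_EGQ (x : P) (H : {group autT}) : Prop :=
  [/\ (forall h, h \in H -> is_aut h),
      (forall h L, h \in H -> I x L -> h.2 L = L)
    & (forall p q, ~~ collinear x p -> ~~ collinear x q ->
         exists! h, h \in H /\ h.1 p = q)].

Definition is_symmetry (x : P) (h : autT) : Prop :=
  is_aut h /\ (forall p, collinear x p -> h.1 p = p).

Definition is_STGQ (t : nat) (x : P) (H : {group autT}) : Prop :=
  is_EGQ x H /\
  exists K : {group autT}, [/\ K \subset H, #|K| = t &
                              forall h, h \in K -> is_symmetry x h].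

Definition prop_star (x : P) (H : {group autT}) : Prop :=
  forall (y : P) (h : autT), y != x -> collinear x y -> h \in H -> h.1 y = y ->
    forall (L : Ln) (z : P), I x L -> I y L -> I z L -> h.1 z = z.

Definition line_stab (H : {group autT}) (L : Ln) : {set autT} :=
  [set h in H | h.2 L == L].

Definition elementary_abelian (A : {set autT}) : Prop :=
  exists p : nat, prime p /\ abelem p A.

Definition stab_fixing_lines_at (H : {group autT}) (L : Ln) (y : P) : {set autT} :=
  [set h in line_stab H L | [forall M, I y M ==> (h.2 M == M)]].

End GQ.

(* Main.v *)
Require Import Defs.
From HB Require Import structures.
From mathcomp Require Import all_boot all_order all_algebra all_fingroup all_solvable.
From mathcomp Require Import zify.
Import GRing.Theory Num.Theory.
Set Implicit Arguments. Unset Strict Implicit. Unset Printing Implicit Defensive.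

(* For a line L off x write A = H_L (of order s); for the line M through x that
   meets L, let S = A K be the pointwise stabilizer of M in H. By property
   [prop_star] S is the stabilizer of any point of M other than x. The t + 1
   groups S are normal in H and meet pairwise in K, so t <= s, hence t < s, and
   H = S B for the stabilizer B of a line meeting another line through x.

   A fixed point congruence modulo the primes l dividing s + t shows that an
   element of S outside K fixes a line off x: otherwise l would divide s t^2,
   whereas s + t, lying strictly between s and 2s with s a power of p, has a
   prime factor l <> p. It follows that the S-conjugates of any 1 <> b in B form
   the coset b K, and that K, hence S, is a p-group.

   Now fix 1 <> b in B. All A-conjugates of b lie in b K, so C_A(b) has at least
   s/t elements. As K = [b, S] lies in the Frattini subgroup of the p-group
   <S, b>, that group is already generated by A and b; both are centralized
   by C_A(b) because A is abelian. So C_A(b) centralizes K, which permutes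
   transitively the lines other than M through the point L meets M in, and
   therefore C_A(b) fixes all these lines. *)

(** * Square-zero matrices and a fixed point congruence for automorphisms *)

(** In a rank factorization [A] = C R, the factor C cancels on the left and R on the right, so C R C
    R = 0 forces R C = 0, and R C has the trace of [A]. *)
Lemma mxtrace_sqr0 (F : fieldType) n (A : 'M[F]_n) :
  (A *m A = 0 -> \tr A = 0)%R.
Proof.
move=> A2; rewrite -(mulmx_base A) mxtrace_mulC.
suff -> : (row_base A *m col_base A = 0)%R by rewrite mxtrace0.
apply: (row_full_inj (col_base_full A)); apply: (row_free_inj (row_base_free A)).
have := A2; rewrite -[X in (X *m _)%R](mulmx_base A).
by rewrite -[X in (_ *m _ *m X)%R](mulmx_base A) /= mulmx0 mul0mx !mulmxA.
Qed.

Section Quadrangle.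

Variables (P Ln : finType) (I : P -> Ln -> bool) (s t : nat).
Hypothesis GQ : is_GQ I s t.

Lemma eq_line p q L M :
  p != q -> I p L -> I q L -> I p M -> I q M -> L = M.
Proof. by case: GQ => _ _ + _; apply. Qed.

Lemma eq_point p q L M :
  L != M -> I p L -> I q L -> I p M -> I q M -> p = q.
Proof.
move=> nLM pL qL pM qM; apply: contraNeq nLM => npq.
exact/eqP/(eq_line npq).
Qed.

Lemma collinearI p q L : I p L -> I q L -> collinear I p q.
Proof. by move=> pL qL; apply/existsP; exists L; rewrite pL. Qed.

Lemma collinearC p q : collinear I p q = collinear I q p.
Proof. by apply: eq_existsb => L; rewrite andbC. Qed.

Lemma eq_proj p L q r : ~~ I p L -> I q L -> I r L ->
  collinear I p q -> collinear I p r -> q = r.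
Proof.
case: GQ => _ _ _ proj pL qL rL cq cr; case: (proj p L pL) => w [_ uw].
by rewrite -(uw q) ?qL // -(uw r) ?rL.
Qed.

Lemma ex_proj p L : ~~ I p L -> exists q M, [/\ I q L, I p M & I q M].
Proof.
case: GQ => _ _ _ proj /proj[q [/andP[qL /existsP[M /andP[pM qM]]] _]].
by exists q, M.
Qed.

Lemma card_points_but p L : I p L -> #|[set q | I q L & q != p]| = s.
Proof.
case: GQ => cL _ _ _ pL; apply/succn_inj; rewrite -(cL L) [RHS](cardsD1 p) inE pL.
by congr (_.+1); apply/eq_card => q; rewrite !inE andbC.
Qed.

Lemma card_lines_but p L : I p L -> #|[set M | I p M & M != L]| = t.
Proof.
case: GQ => _ cP _ _ pL; apply/succn_inj; rewrite -(cP p) [RHS](cardsD1 L) inE pL.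
by congr (_.+1); apply/eq_card => M; rewrite !inE andbC.
Qed.

(** The entries of N N^T for the point-line incidence matrix N, that is, the collinearity matrix
    with diagonal [t.+1]. *)
Definition joins (p q : P) : nat := \sum_L (I p L && I q L).

Lemma joinsxx p : joins p p = t.+1.
Proof.
case: GQ => _ cP _ _; rewrite -(cP p) -sum1_card [RHS]big_mkcond /=.
by apply: eq_bigr => L _; rewrite inE andbb; case: (I p L).
Qed.

Lemma joins_collinear p q : p != q -> joins p q = collinear I p q.
Proof.
move=> npq; case: (boolP (collinear I p q)) => [/existsP[L /andP[pL qL]]|nc].
  rewrite /joins (bigD1 L) //= pL qL big1 // => M nML.
  by case: andP => // -[pM qM]; rewrite (eq_line npq pM qM pL qL) eqxx in nML.
rewrite /joins big1 // => M _; apply/eqP; rewrite eqb0.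
by apply: contraNN nc => /andP[pM qM]; apply: collinearI qM.
Qed.

Lemma joins_noncollinear p q : ~~ collinear I p q -> joins p q = 0.
Proof.
move=> nc; apply: big1 => M _; apply/eqP; rewrite eqb0.
by apply: contraNN nc => /andP[pM qM]; apply: collinearI qM.
Qed.

(** A point off [L] has a single neighbour on [L]; a point on [L] counts [t.+1] for itself and 1 for
    each of the [s] others. *)
Lemma sum_joins_line w L : \sum_(r | I r L) joins r w = 1 + (s + t) * I w L.
Proof.
case: (boolP (I w L)) => wL.
  rewrite (bigD1 w) //= joinsxx muln1 (eq_bigr (fun=> 1)); last first.
    by move=> r /andP[rL nrw]; rewrite joins_collinear // (collinearI rL wL).
  by rewrite sum1_card -(card_points_but wL) cardsE addSn addnC.
have [q [M [qL wM qM]]] := ex_proj wL.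
have nqw : q != w by apply: contraNneq wL => <-.
have cqw : collinear I q w by apply: collinearI wM.
rewrite (bigD1 q) //= joins_collinear // cqw big1 ?muln0 //.
move=> r /andP[rL nrq]; apply: joins_noncollinear.
apply: contraNN nrq => crw; apply/eqP/(eq_proj wL) => //.
  by rewrite collinearC.
by rewrite collinearC.
Qed.

(** The quadratic matrix equation of the quadrangle: expanding [joins u r] over the lines through
    [u] reduces it to [sum_joins_line]. *)
Lemma sum_joins_joins u w :
  \sum_r joins u r * joins r w = t.+1 + (s + t) * joins u w.
Proof.
under eq_bigr => r _ do rewrite big_distrl /=.
rewrite exchange_big /=.
transitivity (\sum_(L | I u L) (1 + (s + t) * I w L)).
  rewrite [RHS]big_mkcond /=; apply: eq_bigr => L _.
  case: (I u L); last by rewrite big1.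
  rewrite -sum_joins_line [RHS]big_mkcond; apply: eq_bigr => r _ /=.
  by case: (I r L); rewrite ?mul1n.
rewrite big_split /= sum1_card; case: GQ => _ cP _ _; rewrite -(cP u) cardsE.
congr (_ + _); rewrite -big_distrr /joins; congr (_ * _) => /=.
by rewrite big_mkcond; apply: eq_bigr => L _; case: (I u L).
Qed.

(* Modulo a prime l dividing s + t the square of the matrix [joins] is
   constant, so ([joins (a u) w] - [joins u w]) squares to zero and is
   traceless: an elementary form of Benson's fixed point congruence. *)
Lemma sum_joins_aut_mod (a : autT P Ln) l : is_aut I a -> prime l ->
  l %| s + t ->
  ((\sum_u joins (a.1 u) u)%:R = (\sum_u joins u u)%:R :> 'F_l)%R.
Proof.
move=> auta pl dvl; pose F := 'F_l.
have joinsJ p q : joins (a.1 p) q = joins p ((a.1^-1)%g q).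
  rewrite /joins (reindex_inj (@perm_inj _ a.2)) /=; apply: eq_bigr => L _.
  by rewrite auta -{1}(permKV a.1 q) auta.
have st0 : ((s + t)%:R = 0 :> F)%R.
  by apply/eqP; rewrite -(dvdn_pcharf (pchar_Fp pl)).
have sq u w : (\sum_r (joins u r)%:R * (joins r w)%:R = t.+1%:R :> F)%R.
  under eq_bigr => r _ do rewrite -natrM.
  by rewrite -natr_sum sum_joins_joins natrD natrM st0 mul0r addr0.
have sum_val (f : P -> F) : (\sum_(k < #|P|) f (enum_val k) = \sum_r f r)%R.
  by rewrite [RHS](reindex _ (onW_bij _ (@enum_val_bij P))).
pose Y : 'M[F]_#|P| := (\matrix_(i, j)
  ((joins (a.1 (enum_val i)) (enum_val j))%:R -
   (joins (enum_val i) (enum_val j))%:R))%R.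
have Y2 : (Y *m Y = 0)%R.
  apply/matrixP => i j; rewrite !mxE.
  under eq_bigr => k _ do rewrite !mxE.
  rewrite (sum_val
    (fun r => ((joins (a.1 (enum_val i)) r)%:R - (joins (enum_val i) r)%:R) *
    ((joins (a.1 r) (enum_val j))%:R - (joins r (enum_val j))%:R))%R) /=.
  (* [joinsJ] moves [a] to the column index, so all four products sum to the same constant [t.+1]
     and cancel. *)
  under eq_bigr => r _ do rewrite (joinsJ r) mulrBl !mulrBr.
  by rewrite !sumrB !sq subrr.
apply/eqP; rewrite -subr_eq0 !natr_sum -sumrB -sum_val; apply/eqP.
by rewrite -[RHS](mxtrace_sqr0 Y2); apply: eq_bigr => k _; rewrite mxE.
Qed.

End Quadrangle.

(** * Line stabilizers and pointwise stabilizers as groups *)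

Section Stabilizers.

Variables (P Ln : finType) (I : P -> Ln -> bool) (H : {group autT P Ln}).

Lemma group_set_line_stab L : group_set (line_stab H L).
Proof.
apply/group_setP; split=> [|g h]; rewrite !inE ?group1 ?perm1 //=.
move=> /andP[gH /eqP gL] /andP[hH /eqP hL].
by rewrite groupM //= permM gL hL.
Qed.

Canonical line_stab_group L := Group (group_set_line_stab L).

Definition point_fixer (M : Ln) : {set autT P Ln} :=
  [set h in H | [forall p, I p M ==> (h.1 p == p)]].

Lemma point_fixerP M h :
  reflect (h \in H /\ forall p, I p M -> h.1 p = p) (h \in point_fixer M).
Proof.
rewrite inE; apply: (iffP andP) => -[hH fix_h]; split=> //.
  by move=> p pM; apply/eqP; have /forallP/(_ p)/implyP := fix_h; apply.
by apply/forallP => p; apply/implyP => /fix_h->.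
Qed.

Lemma group_set_point_fixer M : group_set (point_fixer M).
Proof.
apply/group_setP; split=> [|g h].
  by apply/point_fixerP; split=> // p _; rewrite perm1.
move=> /point_fixerP[gH fg] /point_fixerP[hH fh]; apply/point_fixerP.
by split=> [|p pM]; rewrite ?groupM //= permM fg ?fh.
Qed.

Canonical point_fixer_group M := Group (group_set_point_fixer M).

Lemma point_fixer_sub M : point_fixer M \subset H.
Proof. by apply/subsetP => h /point_fixerP[]. Qed.

Lemma line_stab_sub L : line_stab H L \subset H.
Proof. by apply/subsetP => h; rewrite inE => /andP[]. Qed.

End Stabilizers.

(** * Elations and the points not collinear with [x] *)

Section SkewTranslation.

Variables (P Ln : finType) (I : P -> Ln -> bool) (s t : nat) (x : P).
Variables H K : {group autT P Ln}.
Hypotheses (GQ : is_GQ I s t) (s_gt1 : 1 < s) (t_gt1 : 1 < t).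
Hypotheses (EGQ : is_EGQ I x H) (sKH : K \subset H) (cardK : #|K| = t).
Hypothesis symK : forall h, h \in K -> is_symmetry I x h.
Hypothesis star : prop_star I x H.

Local Notation far u := (~~ collinear I x u).
Local Notation fixer := (point_fixer I H).
Local Notation fixerP := (@point_fixerP _ _ I H _ _).
Local Notation stab := (line_stab H).

Lemma ex_line_but p L : exists2 M, I p M & M != L.
Proof.
have [pL|pL] := boolP (I p L).
  have /card_gt0P[M] : 0 < #|[set M | I p M & M != L]|.
    by rewrite (card_lines_but GQ) // ltnW.
  by rewrite inE => /andP[]; exists M.
have /card_gt0P[M] : 0 < #|[set M | I p M]| by case: GQ => _ ->.
by rewrite inE => pM; exists M => //; apply: contraNneq pL => <-.
Qed.

Lemma ex_point_but L p : exists2 q, I q L & q != p.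
Proof.
have [pL|pL] := boolP (I p L).
  have /card_gt0P[q] : 0 < #|[set q | I q L & q != p]|.
    by rewrite (card_points_but GQ) // ltnW.
  by rewrite inE => /andP[]; exists q.
have /card_gt0P[q] : 0 < #|[set q | I q L]| by case: GQ => ->.
by rewrite inE => qL; exists q => //; apply: contraNneq pL => <-.
Qed.

Lemma elation_inc h p L : h \in H -> I (h.1 p) (h.2 L) = I p L.
Proof. by case: EGQ => aut _ _ /aut. Qed.

Lemma elation_line h L : h \in H -> I x L -> h.2 L = L.
Proof. by case: EGQ => _ + _; apply. Qed.

Lemma elation_inc_line h p L : h \in H -> I x L -> I (h.1 p) L = I p L.
Proof. by move=> hH xL; rewrite -{1}(elation_line hH xL) elation_inc. Qed.

Lemma elation_center h : h \in H -> h.1 x = x.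
Proof.
move=> hH; have /card_gt0P[L] : 0 < #|[set L | I x L]| by case: GQ => _ ->.
rewrite inE => xL; have [M xM nML] := ex_line_but x L.
by apply: (eq_point GQ nML); rewrite ?elation_inc_line.
Qed.

Lemma elation_far h u : h \in H -> far (h.1 u) = far u.
Proof.
move=> hH; congr (~~ _); apply: eq_existsb => L.
by case xL: (I x L); rewrite //= elation_inc_line.
Qed.

Lemma far_line u L : far u -> I u L -> ~~ I x L.
Proof. by move=> fu uL; apply: contraNN fu => /collinearI; apply. Qed.

Lemma line_far L y u : ~~ I x L -> I y L -> collinear I x y ->
  I u L -> u != y -> far u.
Proof.
move=> xL yL cy uL; apply: contraNN => cu.
exact/eqP/(eq_proj GQ xL).
Qed.

Lemma ex_far_line L : ~~ I x L -> exists2 u, far u & I u L.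
Proof.
move=> xL; have [y [M [yL xM yM]]] := ex_proj GQ xL.
have [u uL nuy] := ex_point_but L y; exists u => //.
exact: (line_far xL yL (collinearI xM yM)).
Qed.

Lemma ex_line_off M : I x M ->
  exists y L, [/\ y != x, I y M, I y L & ~~ I x L].
Proof.
move=> xM; have [y yM nyx] := ex_point_but M x.
have [L yL nLM] := ex_line_but y M; exists y, L; split=> //.
by apply: contraNN nLM => xL; apply/eqP/(eq_line GQ nyx).
Qed.

(** The point [y] of [L] collinear with [x] and its image are both the projection of [h.1 u] on the
    line [M] joining [x] and [y], so [h] fixes [y]; then [L] and its image share [y] and [h.1 u]. *)
Lemma elation_far_line h u L : h \in H -> far u -> I u L -> I (h.1 u) L ->
  h.2 L = L.
Proof.
move=> hH fu uL huL; have xL := far_line fu uL.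
have [y [M [yL xM yM]]] := ex_proj GQ xL.
have fhu : far (h.1 u) by rewrite elation_far.
have hyL : I (h.1 y) (h.2 L) by rewrite elation_inc.
have huL' : I (h.1 u) (h.2 L) by rewrite elation_inc.
have hy : h.1 y = y.
  apply: (eq_proj GQ (p := h.1 u) (L := M)) => //.
  - by apply: contraNN fhu => /(collinearI xM).
  - by rewrite elation_inc_line.
  - exact: collinearI hyL.
  - exact: collinearI yL.
apply: (eq_line GQ (p := h.1 u) (q := y)) => //; last by rewrite -{1}hy.
by apply: contraNneq fhu => ->; apply: collinearI yM.
Qed.

Lemma elation_far_inj g h u :
  g \in H -> h \in H -> far u -> g.1 u = h.1 u -> g = h.
Proof.
case: EGQ => _ _ reg gH hH fu egh.
have [|f [_ uf]] := reg u (h.1 u) fu; first by rewrite elation_far.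
by rewrite -(uf g) // -(uf h).
Qed.

Lemma elation_far_fix h u : h \in H -> far u -> h.1 u = u -> h = 1%g.
Proof.
by move=> hH fu hu; apply: (elation_far_inj hH (group1 H) fu); rewrite perm1.
Qed.

(** The stabilizer is regular on the [s] far points of [L]: it acts freely, and an elation joining
    two of them stabilizes [L]. *)
Lemma card_line_stab L : ~~ I x L -> #|stab L| = s.
Proof.
move=> xL; have [y [M [yL xM yM]]] := ex_proj GQ xL.
have [z zL nzy] := ex_point_but L y.
have cxy := collinearI xM yM; have fz := line_far xL yL cxy zL nzy.
rewrite -(card_points_but GQ yL).
rewrite -(card_in_imset (f := fun h : autT P Ln => h.1 z)); last first.
  move=> g h; rewrite !inE => /andP[gH _] /andP[hH _].
  exact: elation_far_inj.
apply: eq_card => w; rewrite inE; apply/imsetP/andP => [[h]|[wL nwy]].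
  rewrite inE => /andP[hH /eqP hL] ->.
  split; first by rewrite -{1}hL elation_inc.
  apply: contraNneq fz => hzy.
  by rewrite -[collinear _ _ _]negbK -(elation_far _ hH) hzy negbK.
have fw := line_far xL yL cxy wL nwy.
have [h [[hH hz] _]] : exists! h, h \in H /\ h.1 z = w by case: EGQ => _ _; apply.
exists h => //; rewrite inE hH /=; apply/eqP.
by apply: (elation_far_line hH fz zL); rewrite hz.
Qed.

Lemma point_fixer_star h y M :
  h \in H -> y != x -> I x M -> I y M -> h.1 y = y -> h \in fixer M.
Proof.
move=> hH nyx xM yM hy; apply/fixerP; split=> // p pM.
exact: (star nyx (collinearI xM yM) hH hy xM yM pM).
Qed.

Lemma point_fixer_normal M : I x M -> (fixer M <| H)%g.
Proof.
move=> xM; rewrite /normal point_fixer_sub; apply/subsetP => g gH.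
rewrite inE; apply/subsetP => _ /imsetP[h /fixerP[hH fh] ->].
apply/fixerP; split=> [|p pM]; first by rewrite groupJ.
rewrite /= !permM fh ?permKV //.
by rewrite -(elation_inc_line _ gH) // permKV.
Qed.

Lemma symmetry_sub_fixer M : I x M -> K \subset fixer M.
Proof.
move=> xM; apply/subsetP => k kK; apply/fixerP; split; first exact: (subsetP sKH).
by have [_ fk] := symK kK => p pM; rewrite fk // (collinearI xM pM).
Qed.

Lemma line_stab_sub_fixer L M y :
  ~~ I x L -> I y L -> I y M -> I x M -> stab L \subset fixer M.
Proof.
move=> xL yL yM xM; apply/subsetP => h; rewrite inE => /andP[hH /eqP hL].
have nyx : y != x by apply: contraNneq xL => <-.
apply: (@point_fixer_star _ y) => //; apply: (eq_point GQ (L := L) (M := M)) => //.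
- by apply: contraNneq xL => ->.
- by rewrite -{1}hL elation_inc.
- by rewrite elation_inc_line.
Qed.

(** A far point [z] of [L2] is the projection on [L2] of a point [y1] of [M1]; since [h] fixes both
    [y1] and [L2], it fixes [z], and elations are free on far points. *)
Lemma point_fixer_line_stab M1 M2 L2 y2 h :
  I x M1 -> I x M2 -> M1 != M2 -> ~~ I x L2 -> I y2 M2 -> I y2 L2 ->
  h \in fixer M1 -> h.2 L2 = L2 -> h = 1%g.
Proof.
move=> xM1 xM2 nM xL2 y2M2 y2L2 /fixerP[hH fh] hL2.
have disj p : I p M1 -> ~~ I p L2.
  move=> pM1; apply/negP => pL2.
  have cxp := collinearI xM1 pM1; have cxy2 := collinearI xM2 y2M2.
  have py2 : p = y2 := eq_proj GQ xL2 pL2 y2L2 cxp cxy2.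
  have : p = x by apply: (eq_point GQ nM) => //; rewrite py2.
  by move=> px; rewrite -px pL2 in xL2.
have [z fz zL2] := ex_far_line xL2.
have zM1 : ~~ I z M1 by apply: contraNN fz => /(collinearI xM1).
have [y1 [N [y1M1 zN y1N]]] := ex_proj GQ zM1.
apply: (elation_far_fix hH fz); apply: (eq_proj GQ (disj _ y1M1)) => //.
- by rewrite -hL2 elation_inc.
- rewrite -(fh _ y1M1).
  by apply: (@collinearI _ _ _ _ _ (h.2 N)); rewrite elation_inc.
- exact: collinearI y1N zN.
Qed.

Lemma symmetry_line_stab k L : k \in K -> ~~ I x L -> k.2 L = L -> k = 1%g.
Proof.
move=> kK xL; have [y [M [yL xM yM]]] := ex_proj GQ xL.
have [N xN nNM] := ex_line_but x M.
apply: (point_fixer_line_stab xN xM nNM xL yM yL).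
exact: (subsetP (symmetry_sub_fixer xN)).
Qed.

(** By [symmetry_line_stab] the orbit of [L] under [K] has [t] elements, as many as there are
    candidates for [N]. *)
Lemma symmetry_trans L M N y : ~~ I x L -> I x M -> I y M -> I y L ->
  I y N -> N != M -> exists2 k, k \in K & k.2 L = N.
Proof.
move=> xL xM yM yL yN nNM.
have nLM : L != M by apply: contraNneq xL => ->.
have kH k : k \in K -> k \in H by apply/subsetP.
pose orbL := [set (k : autT P Ln).2 L | k in K].
have /eqP orbE : orbL == [set N | I y N & N != M].
  rewrite eqEcard (card_lines_but GQ) // card_in_imset ?cardK ?leqnn ?andbT //.
    apply/subsetP => _ /imsetP[k kK ->]; rewrite inE; apply/andP; split.
      have /fixerP[_ fk] := subsetP (symmetry_sub_fixer xM) k kK.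
      by rewrite -(fk y yM) elation_inc ?kH.
    by rewrite -(elation_line (kH k kK) xM) (inj_eq perm_inj).
  move=> g k gK kK egk.
  apply/eqP; rewrite eq_mulgV1; apply/eqP/(@symmetry_line_stab _ L) => //.
    by rewrite groupM ?groupV.
  by rewrite /= permM egk permK.
have : N \in orbL by rewrite orbE inE yN.
by case/imsetP=> k kK ->; exists k.
Qed.

(** Frattini argument: a symmetry taking [L] to [h.2 L] corrects [h] into the stabilizer of [L]. *)
Lemma point_fixerE L M y : ~~ I x L -> I x M -> I y M -> I y L ->
  (stab L * K)%g = fixer M.
Proof.
move=> xL xM yM yL; apply/eqP; rewrite eqEsubset; apply/andP; split.
  by rewrite mul_subG ?(line_stab_sub_fixer xL yL yM xM) ?symmetry_sub_fixer.
apply/subsetP => h /fixerP[hH fh].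
have [||k kK kL] := symmetry_trans (N := h.2 L) xL xM yM yL.
- by rewrite -(fh y yM) elation_inc.
- rewrite -(elation_line hH xM) (inj_eq perm_inj).
  by apply: contraNneq xL => ->.
have kH := subsetP sKH k kK.
apply/mulsgP; exists (h * k^-1)%g k => //; last by rewrite mulgKV.
by rewrite inE groupM ?groupV //= permM -kL permK eqxx.
Qed.

Lemma point_fixerI M1 M2 : I x M1 -> I x M2 -> M1 != M2 ->
  fixer M1 :&: fixer M2 = K.
Proof.
move=> xM1 xM2 nM; apply/eqP; rewrite eqEsubset; apply/andP; split; last first.
  by rewrite subsetI !symmetry_sub_fixer.
apply/subsetP => h /setIP[h1 h2].
have [y [L [nyx yM2 yL xL]]] := ex_line_off xM2.
move: h2; rewrite -(point_fixerE xL xM2 yM2 yL) => /mulsgP[a k aL kK hE].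
suff a1 : a = 1%g by rewrite hE a1 mul1g.
apply: (point_fixer_line_stab xM1 xM2 nM xL yM2 yL).
  rewrite -[a](mulgK k) -hE groupM // groupV.
  exact: (subsetP (symmetry_sub_fixer xM1)).
by move: aL; rewrite inE => /andP[_ /eqP].
Qed.

(** The stabilizer of [L2] has order [s] and acts freely on the [s] points of [M1] other than [x],
    because fixing one of them means fixing [M1] pointwise. *)
Lemma line_stab_trans M1 M2 L2 y2 y w :
  I x M1 -> I x M2 -> M1 != M2 -> ~~ I x L2 -> I y2 M2 -> I y2 L2 ->
  I y M1 -> y != x -> I w M1 -> w != x -> exists2 b, b \in stab L2 & b.1 y = w.
Proof.
move=> xM1 xM2 nM xL2 y2M2 y2L2 yM1 nyx wM1 nwx.
have bH b : b \in stab L2 -> b \in H by apply/subsetP/line_stab_sub.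
pose orby := [set (b : autT P Ln).1 y | b in stab L2].
have sub : orby \subset [set q | I q M1 & q != x].
  apply/subsetP => _ /imsetP[b /bH{}bH ->]; rewrite inE elation_inc_line // yM1.
  by rewrite -(elation_center bH) (inj_eq perm_inj).
have /eqP E : orby == [set q | I q M1 & q != x].
  rewrite eqEcard sub (card_points_but GQ) //.
  rewrite card_in_imset ?card_line_stab ?leqnn //.
  move=> g b gL bL egb; apply/eqP; rewrite eq_mulgV1; apply/eqP.
  have gbL : (g * b^-1)%g \in stab L2 by rewrite groupM ?groupV.
  apply: (point_fixer_line_stab xM1 xM2 nM xL2 y2M2 y2L2).
    apply: (point_fixer_star (bH _ gbL) nyx) => //.
    by rewrite /= permM egb permK.
  by move: gbL; rewrite inE => /andP[_ /eqP].
have : w \in [set q | I q M1 & q != x] by rewrite inE wM1.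
by rewrite -E => /imsetP[b bL ->]; exists b.
Qed.

Lemma elation_decomp M1 M2 L2 y2 :
  I x M1 -> I x M2 -> M1 != M2 -> ~~ I x L2 -> I y2 M2 -> I y2 L2 ->
  (fixer M1 * stab L2)%g = H.
Proof.
move=> xM1 xM2 nM xL2 y2M2 y2L2; apply/eqP; rewrite eqEsubset.
rewrite mul_subG ?point_fixer_sub ?line_stab_sub //=; apply/subsetP => h hH.
have [y yM1 nyx] := ex_point_but M1 x.
have [||b bL by_] :=
  line_stab_trans (w := h.1 y) xM1 xM2 nM xL2 y2M2 y2L2 yM1 nyx.
- by rewrite elation_inc_line.
- by rewrite -(elation_center hH) (inj_eq perm_inj).
have bH := subsetP (line_stab_sub H L2) _ bL.
apply/mulsgP; exists (h * b^-1)%g b => //; last by rewrite mulgKV.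
apply: (point_fixer_star (y := y)) => //; first by rewrite groupM ?groupV.
by rewrite /= permM -by_ permK.
Qed.

(** For each of the [t] lines [M] other than [M1] through [x], choose an element of [fixer M] moving
    [y1] to [w1]. The images of [y2] under these elements are distinct points of [M2] other than
    [x], of which there are [s]. *)
Lemma leq_order : t <= s.
Proof.
have /card_gt0P[M1] : 0 < #|[set L | I x L]| by case: GQ => _ ->.
rewrite inE => xM1; have [M2 xM2 nM21] := ex_line_but x M1.
have nM12 : M1 != M2 by rewrite eq_sym.
have : 1 < #|[set q | I q M1 & q != x]| by rewrite (card_points_but GQ).
case/card_gt1P=> y1 [w1 [+ + ny1w1]].
rewrite !inE => /andP[y1M1 ny1x] /andP[w1M1 nw1x].
have [y2 y2M2 ny2x] := ex_point_but M2 x.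
have ex_move M : I x M -> M != M1 -> exists2 b, b \in fixer M & b.1 y1 = w1.
  move=> xM nM; have [y [L [nyx yM yL xL]]] := ex_line_off xM.
  have nM1 : M1 != M by rewrite eq_sym.
  have [b bL bw] := line_stab_trans xM1 xM nM1 xL yM yL y1M1 ny1x w1M1 nw1x.
  by exists b => //; apply: (subsetP (line_stab_sub_fixer xL yL yM xM)).
(* By [ex_move] the default [1] is never taken on the lines that matter. *)
pose f M := odflt 1%g [pick b in fixer M | b.1 y1 == w1].
have fP M : I x M -> M != M1 -> f M \in fixer M /\ (f M).1 y1 = w1.
  move=> xM nM; rewrite /f; case: pickP => [b /andP[? /eqP]|none] //=.
  by have [b bM bw] := ex_move M xM nM; have := none b; rewrite /= bM bw eqxx.
rewrite -(card_lines_but GQ xM1) -(card_points_but GQ xM2).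
rewrite -(card_in_imset (f := fun M => (f M).1 y2)).
  apply: subset_leq_card; apply/subsetP => _ /imsetP[M + ->].
  rewrite inE => /andP[xM nM].
  have [/fixerP[bH _] _] := fP M xM nM.
  by rewrite inE elation_inc_line // y2M2 -(elation_center bH) (inj_eq perm_inj).
move=> M N; rewrite !inE => /andP[xM nM] /andP[xN nN] eMN.
have [fM fM1] := fP M xM nM; have [fN fN1] := fP N xN nN.
have [//|nMN] := eqVneq M N.
have /fixerP[fMH _] := fM; have /fixerP[fNH _] := fN.
have gH : (f M * (f N)^-1)%g \in H by rewrite groupM ?groupV.
have gK : (f M * (f N)^-1)%g \in K.
  rewrite -(point_fixerI xM1 xM2 nM12); apply/setIP; split.
    by apply: (point_fixer_star gH ny1x) => //; rewrite /= permM fM1 -fN1 permK.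
  by apply: (point_fixer_star gH ny2x) => //; rewrite /= permM eMN permK.
(* [f M] and [f N] agree modulo [K], so [f M] lies in both fixers and hence in [K], which fixes
   [y1]. *)
have : f M \in K.
  rewrite -(point_fixerI xM xN nMN); apply/setIP; split=> //.
  rewrite -[f M](mulgKV (f N)) groupM //.
  exact: (subsetP (symmetry_sub_fixer xN)).
move/(subsetP (symmetry_sub_fixer xM1))/fixerP => [_ /(_ _ y1M1)].
by rewrite fM1 => w1y1; rewrite w1y1 eqxx in ny1w1.
Qed.

(** * Fixed point counts and lines fixed off [x] *)

(** Counts the flags on lines through [x], where [x] itself occurs [t.+1] times instead of once. *)
Lemma sum_collinear : \sum_u collinear I x u = s * t + s.+1.
Proof.
have E : \sum_u joins I x u = \sum_u (collinear I x u + t * (u == x)).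
  apply: eq_bigr => u _; have [->|nux] := eqVneq u x.
    rewrite (joinsxx GQ) muln1.
    suff -> : collinear I x x by [].
    have /card_gt0P[M] : 0 < #|[set L | I x L]| by case: GQ => _ ->.
    by rewrite inE => xM; exact: (collinearI xM).
  by rewrite (joins_collinear GQ) 1?eq_sym // muln0 addn0.
have Ex : \sum_u (u == x) = 1.
  by rewrite (bigD1 x) //= eqxx big1 // => u /negbTE->.
move: E; rewrite big_split /= -big_distrr /= Ex muln1 /joins exchange_big /=.
rewrite (eq_bigr (fun L => I x L * s.+1)) => [|L _]; last first.
  have cL : #|[set p | I p L]| = s.+1 by case: GQ => ->.
  rewrite -cL -sum1_card big_distrr [RHS]big_mkcond /=; apply: eq_bigr => u _.
  by rewrite inE; case: (I u L); case: (I x L).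
rewrite -big_distrl /= (eq_bigr (fun L => (I x L && I x L) : nat)); last first.
  by move=> L _; rewrite andbb.
rewrite -/(joins I x x) (joinsxx GQ); nia.
Qed.

(* A symmetry maps no far point to a collinear one, whereas [h] maps every
   point of the perp of [x] off [M] to a distinct collinear point; the
   resulting fixed point counts differ by s t^2. *)
Lemma fixer_fixes_line p M h : prime p -> p.-nat s -> t < s ->
  I x M -> h \in fixer M -> h \notin K -> exists2 L, ~~ I x L & h.2 L = L.
Proof.
move=> pp ps lt_ts xM hM hK; have /fixerP[hH fh] := hM.
have [|noL] := boolP [exists L, ~~ I x L && (h.2 L == L)].
  by case/existsP=> L /andP[xL /eqP hL]; exists L.
have {}noL u L : far u -> I u L -> ~~ I (h.1 u) L.
  move=> fu uL; apply: contraNN noL => huL; apply/existsP; exists L.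
  by rewrite (far_line fu uL) (elation_far_line hH fu uL huL) eqxx.
have [k kK nk1] : exists2 k, k \in K & k != 1%g.
  by apply/trivgPn; rewrite -cardG_gt1 cardK.
have kH := subsetP sKH k kK.
have [l [pl lst nlp]] : exists l, [/\ prime l, l %| s + t & l != p].
  have [pst|] := boolP (p.-nat (s + t)); last first.
    rewrite /pnat; have -> : 0 < s + t by lia.
    move=> /= /allPn[l]; rewrite mem_primes => /and3P[pl _ ldv] lp.
    by exists l.
  have [m sE] := p_natP ps; have [n stE] := p_natP pst.
  have : p ^ m < p ^ n by rewrite -sE -stE; lia.
  rewrite ltn_exp2l ?prime_gt1 // => lt_mn.
  have : p ^ m.+1 <= p ^ n by rewrite leq_exp2l ?prime_gt1.
  rewrite expnS -sE -stE; have := prime_gt1 pp; nia.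
have autH g : g \in H -> is_aut I g by case: EGQ => aut _ _ /aut.
have := etrans (sum_joins_aut_mod GQ (autH h hH) pl lst)
  (esym (sum_joins_aut_mod GQ (autH k kH) pl lst)).
have -> : \sum_u joins I (k.1 u) u = \sum_u t.+1 * collinear I x u.
  apply: eq_bigr => u _; have [cxu|fu] := boolP (collinear I x u).
    by have [_ ->] := symK kK; rewrite // (joinsxx GQ) muln1.
  rewrite muln0 joins_noncollinear //; apply: contraNN nk1.
  case/existsP=> L /andP[kuL uL]; apply/eqP.
  apply: (symmetry_line_stab kK (far_line fu uL)).
  exact: (elation_far_line kH fu uL).
have -> : \sum_u joins I (h.1 u) u = \sum_u (collinear I x u + t * I u M).
  apply: eq_bigr => u _; have [uM|uM] := boolP (I u M).
    by rewrite fh // (joinsxx GQ) (collinearI xM uM) muln1.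
  rewrite muln0 addn0; have [cxu|fu] := boolP (collinear I x u); last first.
    apply: joins_noncollinear; apply/existsP => -[L /andP[huL uL]].
    by move/negP: (noL u L fu uL).
  have /existsP[N /andP[xN uN]] := cxu.
  have nux : u != x by apply: contraNneq uM => ->.
  have nNM : N != M by apply: contraNneq uM => <-.
  rewrite (joins_collinear GQ); last first.
    apply: contraNneq hK => hu; rewrite -(point_fixerI xN xM nNM) inE hM andbT.
    exact: (point_fixer_star hH nux).
  by rewrite (@collinearI _ _ _ _ _ N) ?elation_inc_line.
rewrite big_split /= -!big_distrr /= sum_collinear.
have -> : \sum_u I u M = s.+1.
  have <- : #|[set p | I p M]| = s.+1 by case: GQ => ->.
  rewrite -sum1_card [RHS]big_mkcond; apply: eq_bigr => u _ /=.
  by rewrite inE; case: (I u M).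
(* The counts differ by [t * (s * t)], so [l] would divide [s] or [t]. As [l] divides [s + t],
   either case gives a divisor of [s], a power of [p]. *)
have -> : t.+1 * (s * t + s.+1) = s * t + s.+1 + t * s.+1 + t * (s * t) by nia.
rewrite [in RHS]natrD -[LHS]addr0 => /addrI/esym/eqP.
rewrite -(dvdn_pcharf (pchar_Fp pl)) !Euclid_dvdM //.
have ls : ~~ (l %| s).
  by apply: contraNN nlp => /(pnatP _ (ltnW s_gt1) ps l pl); rewrite inE.
have lt : ~~ (l %| t) by apply: contraNN ls => lt; rewrite -(dvdn_addl _ lt).
by rewrite (negbTE ls) (negbTE lt).
Qed.

(** * Conjugacy modulo [K] and the p-group property *)

(** [b * k] fixes a line [L] off [x]. Write an elation taking [L2] to [L] as b' g1 with b' in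
    [stab L2] and g1 in [fixer M1]; commutativity of [stab L2] removes b', so [b * k] is a
    g1-conjugate of some [c] in [stab L2], and [c] equals [b] modulo [K], hence exactly. *)
Lemma conj_fixer p M1 M2 L2 y2 b k : prime p -> p.-nat s -> t < s ->
  I x M1 -> I x M2 -> M1 != M2 -> ~~ I x L2 -> I y2 M2 -> I y2 L2 ->
  abelian (stab L2) -> b \in stab L2 -> b != 1%g -> k \in K ->
  exists2 g, g \in fixer M1 & (b ^ g = b * k)%g.
Proof.
move=> pp ps lt_ts xM1 xM2 nM xL2 y2M2 y2L2 abL2 bL2 nb1 kK.
have sLM := subsetP (line_stab_sub_fixer xL2 y2L2 y2M2 xM2).
have kM2 := subsetP (symmetry_sub_fixer xM2) k kK.
have bM2 := sLM b bL2.
have bkM2 : (b * k)%g \in fixer M2 by rewrite groupM.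
have nbkK : (b * k)%g \notin K.
  rewrite groupMr //; apply: contraNN nb1 => bK; apply/eqP.
  by apply: (symmetry_line_stab bK xL2); move: bL2; rewrite inE => /andP[_ /eqP].
have [L xL bkL] := fixer_fixes_line pp ps lt_ts xM2 bkM2 nbkK.
have bkH := subsetP (point_fixer_sub I H M2) _ bkM2.
have [y [M [yL xM yM]]] := ex_proj GQ xL.
(* If [L] met another line through [x], [b * k] would lie in two fixers, hence in [K]. *)
have MM2 : M = M2.
  apply: contraNeq nbkK => nMM2.
  rewrite -(point_fixerI xM xM2 nMM2) inE bkM2 andbT.
  apply: (subsetP (line_stab_sub_fixer xL yL yM xM)).
  by rewrite inE bkH bkL eqxx.
have [z fz zL2] := ex_far_line xL2; have [w fw wL] := ex_far_line xL.
have [g [[gH gz] _]] : exists! h, h \in H /\ h.1 z = w by case: EGQ => _ _; apply.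
have gL2 : g.2 L2 = L.
  have wM2 : ~~ I w M2 by apply: contraNN fw => /(collinearI xM2).
  have gy2L : I (g.1 y2) (g.2 L2) by rewrite elation_inc.
  have wgL : I w (g.2 L2) by rewrite -gz elation_inc.
  have gy2 : g.1 y2 = y.
    apply: (eq_proj GQ wM2); rewrite ?elation_inc_line -?MM2 //; first by rewrite MM2.
      exact: collinearI gy2L.
    exact: collinearI yL.
  apply: (eq_line GQ (p := w) (q := y)) => //; last by rewrite -{1}gy2.
  by apply: contraNneq fw => ->; apply: collinearI yM.
have nM1 := point_fixer_normal xM1; have nM2 := point_fixer_normal xM2.
have defH : (stab L2 * fixer M1)%g = H.
  rewrite (normC (subset_trans (line_stab_sub H L2) (normal_norm nM1))).
  exact: elation_decomp xM1 xM2 nM xL2 y2M2 y2L2.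
have := gH; rewrite -defH => /mulsgP[b' g1 b'L2 g1M1 gE].
pose c := ((b * k) ^ g^-1)%g.
have cL2 : c \in stab L2.
  have bkL' : k.2 (b.2 L) = L by move: bkL; rewrite permM.
  rewrite inE groupJ ?groupV // /c conjgE invgK /= !permM gL2 bkL' -gL2 permK.
  by rewrite eqxx.
have cg1 : (c ^ g1 = b * k)%g.
  rewrite -[RHS](conjgKV g) -/c gE conjgM; congr (_ ^ _)%g.
  by rewrite conjgE (centsP abL2 _ cL2 _ b'L2) mulKg.
have cK : [~ c, g1]%g \in K.
  rewrite -(point_fixerI xM1 xM2 nM); apply/setIP.
  have nfix M' : I x M' -> H \subset 'N(fixer M')%g.
    by move=> xM'; apply/normal_norm/point_fixer_normal.
  have cH := subsetP (line_stab_sub H L2) c cL2.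
  have g1H := subsetP (point_fixer_sub I H M1) g1 g1M1.
  split.
    by rewrite commgEr groupM // memJ_norm ?groupV // (subsetP (nfix _ xM1)).
  have cM2 := sLM c cL2.
  by rewrite commgEl groupM ?groupV // memJ_norm // (subsetP (nfix _ xM2)).
(* The quotient lies both in [K] and in [stab L2], which meet trivially. *)
have cb : c = b.
  apply/eqP; rewrite eq_mulVg1; apply/eqP/(@symmetry_line_stab _ L2) => //.
    have := cg1; rewrite conjg_mulR => /(canRL (mulKg _)) cE.
    suff -> : (c^-1 * b = [~ c, g1] * k^-1)%g by rewrite groupM ?groupV.
    by rewrite cE mulgA mulgK.
  have : (c^-1 * b)%g \in stab L2 by rewrite groupM ?groupV.
  by rewrite inE => /andP[_ /eqP].
by exists g1 => //; rewrite -cg1 cb.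
Qed.

Lemma symmetry_normal : (K <| H)%g.
Proof.
have /card_gt0P[M1] : 0 < #|[set L | I x L]| by case: GQ => _ ->.
rewrite inE => xM1; have [M2 xM2 nM] := ex_line_but x M1.
by rewrite -(point_fixerI xM2 xM1 nM) normalI ?point_fixer_normal.
Qed.

Lemma card_point_fixer M : I x M -> #|fixer M| = s * t.
Proof.
move=> xM; have [y [L [_ yM yL xL]]] := ex_line_off xM.
rewrite -(point_fixerE xL xM yM yL) TI_cardMg ?card_line_stab ?cardK //.
apply/trivgP/subsetP => h /setIP[]; rewrite !inE => /andP[_ /eqP hL] hK.
exact/eqP/(symmetry_line_stab hK xL).
Qed.

(* Every element of [fixer M] outside [K] is conjugate into [stab L], so a
   p'-element of [K] has all its centralizer in [K], hence at least s > t
   conjugates there. *)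
Lemma symmetry_pgroup p L M y : prime p -> (p.-abelem (stab L))%g -> t < s ->
  ~~ I x L -> I x M -> I y M -> I y L -> (p.-group K)%g.
Proof.
move=> pp abL lt_ts xL xM yM yL.
have ps : p.-nat s by have := abelem_pgroup abL; rewrite /pgroup card_line_stab.
have fixer_expp h : h \in fixer M -> h \notin K -> (h ^+ p = 1)%g.
  rewrite -(point_fixerE xL xM yM yL) => /mulsgP[a k aL kK ->] nK.
  have [N xN nNM] := ex_line_but x M.
  have na1 : a != 1%g by apply: contraNneq nK => ->; rewrite mul1g.
  have [cLL expL] := abelemP pp abL.
  have [g _ <-] := conj_fixer pp ps lt_ts xN xM nNM xL yM yL cLL aL na1 kK.
  by rewrite -conjXg expL // conj1g.
apply/pgroupP => r pr; case/(Cauchy pr) => k kK ok.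
apply/contraT => nrp.
have cKk : ('C_(fixer M)[k] \subset K)%g.
  apply/subsetP => h /setIP[hM /cent1P chk]; apply: contraT => hK.
  have hkM : (h * k)%g \in fixer M.
    by rewrite groupM //; apply: (subsetP (symmetry_sub_fixer xM)).
  have hkK : (h * k)%g \notin K by rewrite groupMr.
  (* Both [h] and [h * k] have trivial p-th power and [h] commutes with [k], so [k] does too,
     contradicting its order [r]. *)
  have := fixer_expp _ hkM hkK; rewrite expgMn // fixer_expp // mul1g => /eqP.
  rewrite -order_dvdn ok dvdn_prime2 // => /eqP rp.
  by rewrite rp inE eqxx in nrp.
have nKM : fixer M \subset 'N(K)%g.
  exact: subset_trans (point_fixer_sub I H M) (normal_norm symmetry_normal).
have := subset_leq_card cKk.
have : #|(k ^: fixer M)%g| <= t.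
  by rewrite -cardK subset_leq_card // class_sub_norm.
have := Lagrange (subcent1_sub k (fixer M)).
rewrite index_cent1 card_point_fixer // cardK.
by set u := #|_|; set v := #|_| => E lev leu; have := leq_mul leu lev; nia.
Qed.

(** * The centralizer of [b] and the final bound *)

Lemma card_fixing_lines L y : t < s -> ~~ I x L -> I y L -> collinear I x y ->
  (forall L, ~~ I x L -> elementary_abelian (line_stab H L)) ->
  s <= t * #|stab_fixing_lines_at I H L y|.
Proof.
move=> lt_ts xL yL /existsP[M /andP[xM yM]] elem.
have [p [pp abL]] := elem L xL.
have ps : p.-nat s by have := abelem_pgroup abL; rewrite /pgroup card_line_stab.
have [N xN nNM] := ex_line_but x M; have nMN : M != N by rewrite eq_sym.
have [z [L' [_ zN zL' xL']]] := ex_line_off xN.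
have [p' [_ /abelem_abelian abL']] := elem L' xL'.
have [b bL' nb1] : exists2 b, b \in stab L' & b != 1%g.
  by apply/trivgPn; rewrite -cardG_gt1 card_line_stab.
have sLM := line_stab_sub_fixer xL yL yM xM.
have bN := subsetP (line_stab_sub_fixer xL' zL' zN xN) b bL'.
have bH := subsetP (line_stab_sub H L') b bL'.
have nfix M' : I x M' -> H \subset 'N(fixer M')%g.
  by move=> xM'; apply/normal_norm/point_fixer_normal.
(* A commutator of [b] with an element of [stab L] lies in the normal subgroups [fixer M] and
   [fixer N], whose intersection is [K]. *)
have class_b : (b ^: stab L \subset b *: K)%g.
  apply/subsetP => _ /imsetP[a aL ->]; apply/lcosetP; exists [~ b, a]%g; last first.
    by rewrite -conjg_mulR.
  have aM := subsetP sLM a aL; have aH := subsetP (line_stab_sub H L) a aL.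
  rewrite -(point_fixerI xM xN nMN); apply/setIP; split.
    by rewrite commgEr groupM // memJ_norm ?groupV // (subsetP (nfix _ xM)).
  by rewrite commgEl groupM ?groupV // memJ_norm // (subsetP (nfix _ xN)).
have pK := symmetry_pgroup pp abL lt_ts xL xM yM yL.
have pM : (p.-group (fixer M))%g.
  by rewrite -(point_fixerE xL xM yM yL) pgroupM pK (abelem_pgroup abL).
have pY : (p.-group (fixer M <*> <[b]>))%g.
  rewrite norm_joinEr ?cycle_subG ?(subsetP (nfix _ xM)) // pgroupM pM /=.
  (* [stab L'] is a p-group for the prime [p] of [L], since all these line stabilizers have order
     [s]. *)
  apply: (pgroupS (G := stab L')%G); first by rewrite cycle_subG.
  by rewrite /pgroup card_line_stab.
have sKPhi : (K \subset 'Phi(fixer M <*> <[b]>))%g.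
  apply/subsetP => k kK; rewrite (Phi_joing pY); apply/(subsetP (joing_subl _ _)).
  have [g gM bg] := conj_fixer pp ps lt_ts xM xN nMN xL' zN zL' abL' bL' nb1 kK.
  have -> : (k = [~ b, g])%g by rewrite commgEl bg mulKg.
  by rewrite mem_commg ?mem_gen // inE ?cycle_id ?gM ?orbT.
have genY : (stab L <*> <[b]> = fixer M <*> <[b]>)%g.
  rewrite -[LHS]genGid; apply: Phi_nongen; apply/eqP; rewrite eqEsubset.
  apply/andP; split.
    by rewrite !join_subG Phi_sub joing_subr (subset_trans sLM (joing_subl _ _)).
  rewrite join_subG (subset_trans (joing_subr (stab L) _) (joing_subr _ _)) andbT.
  rewrite -{1}(point_fixerE xL xM yM yL) mul_subG //.
    exact: subset_trans (joing_subl _ _) (joing_subr _ _).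
  exact: subset_trans sKPhi (joing_subl _ _).
(* Every line [N'] through [y] other than [M] is the image of [L] under some [k] in [K]; [c] fixes
   [L] and commutes with [k], hence fixes [N']. *)
have sC : ('C_(stab L)[b] \subset stab_fixing_lines_at I H L y)%g.
  apply/subsetP => c /setIP[cL cb]; rewrite inE cL; apply/forallP => N'.
  apply/implyP => yN'; have cH := subsetP (line_stab_sub H L) c cL.
  have [->|nN'M] := eqVneq N' M; first by rewrite (elation_line cH xM).
  have [k kK <-] := symmetry_trans xL xM yM yL yN' nN'M.
  have : c \in 'C(stab L <*> <[b]>)%g.
    by rewrite centY inE cent_cycle (subsetP (abelem_abelian abL)) //.
  rewrite genY => /centP/(_ k) cck.
  have ck : commute c k.
    apply: cck; apply: (subsetP (joing_subl _ _)).
    exact: (subsetP (symmetry_sub_fixer xM)).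
  have cL2 : c.2 L = L by move: cL; rewrite inE => /andP[_ /eqP].
  by rewrite -permM -[(k.2 * c.2)%g]/((k * c)%g.2) -ck /= permM cL2.
(* Orbit counting: the class has at most [t] elements, and its size times that of the centralizer is
   [s]. *)
have := subset_leq_card sC; have := subset_leq_card class_b.
have := Lagrange (subcent1_sub b (stab L)).
rewrite index_cent1 card_lcoset cardK card_line_stab //.
by set u := #|_|; set v := #|_| => <- lev leu; rewrite mulnC leq_mul.
Qed.

End SkewTranslation.

Local Open Scope ring_scope.

Theorem mainTheorem15 (P Ln : finType) (I : P -> Ln -> bool) (s t : nat)
  (x : P) (H : {group autT P Ln}) :
  is_GQ I s t -> thick s t -> s <> t ->
  is_STGQ I t x H -> prop_star I x H ->
  (forall L : Ln, ~~ I x L -> elementary_abelian (line_stab H L)) ->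
  1 < s%:Q / t%:Q /\
  (forall (L : Ln) (y : P), ~~ I x L -> I y L -> collinear I x y ->
     s%:Q / t%:Q <= (#|stab_fixing_lines_at I H L y|)%:Q).
Proof.
move=> GQ [s1 t1] nst [EGQ [K [sKH cK symK]]] star elem.
have lt_ts : (t < s)%N.
  rewrite ltn_neqAle (leq_order GQ s1 t1 EGQ sKH cK symK star) andbT.
  by apply/eqP => ts; apply: nst.
have t0 : (0 < t%:Q)%R by rewrite ltr0n ltnW.
split; first by rewrite ltr_pdivlMr // mul1r ltr_nat.
move=> L y xL yL cxy; rewrite ler_pdivrMr // -natrM ler_nat mulnC.
exact: (card_fixing_lines GQ s1 t1 EGQ sKH cK symK star).
Qed.
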